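(* The set of separable states of $\mathcal{B}(\mathbb{C}^2\otimes\mathbb{C}^2)$ is not affinely isomorphic to the state space of any JB algebra.
   Context: States of $\mathcal{B}(\mathbb{C}^2\otimes\mathbb{C}^2)$ are identified with density operators on $\mathbb{C}^2\otimes\mathbb{C}^2$; the separable states are the convex combinations of pure product states $E\otimes F$, with $E,F$ rank-one projections on $\mathbb{C}^2$. A Jordan algebra is a real vector space with a commutative bilinear product $\circ$ satisfying $((A\circ A)\circ B)\circ A=(A\circ A)\circ(B\circ A)$. A JB algebra is a unital Jordan algebra complete with respect to a norm satisfying $\|A\circ B\|\le\|A\|\|B\|$, $\|A\circ A\|=\|A\|^2$, $\|A\circ A\|\le\|A\circ A+B\circ B\|$. A state is a continuous linear $\omega:\mathcal{A}\to\mathbb{R}$ with $\omega(I)=1$ and $\omega(A\circ A)\ge0$; the state space is the convex set of states. An affine isomorphism is a bijection preserving convex combinations. *)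

(* Defs.v *)
From HB Require Import structures.
From mathcomp Require Import all_boot all_order all_algebra.
From mathcomp Require Import all_classical all_reals all_analysis.
From mathcomp Require Import complex mxtens.
Set Implicit Arguments. Unset Strict Implicit. Unset Printing Implicit Defensive.
Import Order.TTheory GRing.Theory Num.Theory.
Import numFieldNormedType.Exports.
Local Open Scope classical_set_scope.
Local Open Scope ring_scope.

Section Quantum.
Variable R : realType.
Local Notation C := (complex R).

Definition adjmx {m n} (A : 'M[C]_(m, n)) : 'M[C]_(n, m) :=
  (map_mx Num.conj A)^T.

Definition rank_one_proj (E : 'M[C]_2) : Prop :=
  [/\ adjmx E = E, E *m E = E & \rank E = 1%N].

Definition separable_states : set 'M[C]_(2 * 2) :=
  [set rho | exists (n : nat) (w : 'I_n -> R) (E F : 'I_n -> 'M[C]_2),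
     [/\ (forall i, 0 <= w i), \sum_(i < n) w i = 1,
         (forall i, rank_one_proj (E i) /\ rank_one_proj (F i)) &
         rho = \sum_(i < n) ((w i)%:C)%C *: (E i *t F i)]].
End Quantum.
Arguments separable_states R : clear implicits.

Section JB.
Variable R : realType.
Variable V : completeNormedModType R.

(** unital Jordan algebra (product commutative, bilinear -- linearity in
    the second argument follows from commutativity --, Jordan identity,
    unit e) *)
Definition is_unital_Jordan_algebra (mul : V -> V -> V) (e : V) : Prop :=
  [/\ (forall a b, mul a b = mul b a),
      (forall a b c, mul (a + b) c = mul a c + mul b c),
      (forall (t : R) a b, mul (t *: a) b = t *: mul a b),
      (forall a b, mul (mul (mul a a) b) a = mul (mul a a) (mul b a)) &
      (forall a, mul e a = a)].

Definition is_JB_algebra (mul : V -> V -> V) (e : V) : Prop :=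
  [/\ is_unital_Jordan_algebra mul e,
      (forall a b, `|mul a b| <= `|a| * `|b|),
      (forall a, `|mul a a| = `|a| ^+ 2) &
      (forall a b, `|mul a a| <= `|mul a a + mul b b|)].

Definition JB_states (mul : V -> V -> V) (e : V) : set (V -> R) :=
  [set w | [/\ (forall a b, w (a + b) = w a + w b),
              (forall (t : R) a, w (t *: a) = t * w a),
              continuous w,
              w e = 1 &
              (forall a, 0 <= w (mul a a))]].
End JB.

Definition affine_iso (R : realType) (m n : nat) (T : Type)
  (S : set 'M[complex R]_(m, n)) (K : set (T -> R))
  (f : 'M[complex R]_(m, n) -> (T -> R)) : Prop :=
  [/\ set_bij S K f &
  forall x y (t : R), x \in S -> y \in S -> 0 <= t <= 1 ->
    f ((t%:C)%C *: x + ((1 - t)%:C)%C *: y) = (fun a => t * f x a + (1 - t) * f y a)].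

(* Main.v *)
Require Import Defs.
From HB Require Import structures.
From mathcomp Require Import all_boot all_order all_algebra.
From mathcomp Require Import all_classical all_reals all_analysis.
From mathcomp Require Import complex mxtens.
From mathcomp Require Import ring lra.
Import Order.TTheory GRing.Theory Num.Theory.
Import numFieldNormedType.Exports.
Local Open Scope classical_set_scope.
Local Open Scope ring_scope.

(** Let xi and ze be the affine functions rho |-> Tr((sx (x) sx) rho) and
    rho |-> Tr((sz (x) sz) rho) on the separable states.  If the separable
    states were affinely isomorphic to the state space of a JB algebra, xi and
    ze would be represented by elements of the algebra, because the separable
    states lie in a finite-dimensional space.  On separable states
    |xi| + |ze| <= 1.  In a JB algebra, a state w vanishing on an element c that
    is nonnegative on all states satisfies w (c o x) = 0 for all x.  Applied to
    1 -+ ze this gives w (ze o ze) = 1 whenever w ze = +-1; applied to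
    1 -+ xi - ze and 1 -+ xi + ze it gives w (ze o ze) = 0 whenever w xi = +-1.
    But the maximally mixed state is at the same time the average of four product
    states with ze = +-1 and the average of four product states with xi = +-1.

    The property of JB algebras used here follows from w (c o c) <= 2 w c for
    c >= 0 of norm < 1, which holds since |1 - c| <= 1; the latter needs enough
    states, hence the Hahn-Banach theorem. *)

(** * The Hahn-Banach theorem *)

Section HahnBanach.
Context {R : realType} {V : lmodType R}.
Implicit Types (p q : V -> R) (x y : V).

Definition sublinear p : Prop :=
  (forall x y, p (x + y) <= p x + p y) /\
  (forall (t : R) x, 0 < t -> p (t *: x) <= t * p x).

(** The inequality for [t^-1] reverses the one for [t]; at [t = 0], halving gives [p 0 <= 0] and
    subadditivity gives the converse. *)
Lemma sublinearZ p t x : sublinear p -> 0 <= t -> p (t *: x) = t * p x.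
Proof.
move=> [pD pZ]; rewrite le_eqVlt => /predU1P[<-|t0].
  rewrite scale0r mul0r; apply/eqP; rewrite eq_le; apply/andP; split.
    by have := pZ 2 0 ltac:(lra); have := pZ 2^-1 0 ltac:(lra); rewrite !scaler0; lra.
  by have := pD 0 0; rewrite addr0; lra.
apply/eqP; rewrite eq_le pZ//=.
have := pZ t^-1 (t *: x); rewrite invr_gt0 t0 => /(_ isT).
by rewrite scalerA mulVf ?gt_eqF// scale1r ler_pdivlMl.
Qed.

Lemma sublinear0 p : sublinear p -> p 0 = 0.
Proof. by move=> sp; rewrite -(scale0r 0) sublinearZ// mul0r. Qed.

Lemma sublinearN p x : sublinear p -> - p (- x) <= p x.
Proof. by move=> sp; have := sp.1 x (- x); rewrite subrr sublinear0//; lra. Qed.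

(* The largest sublinear functional q <= p with q (- y) <= - p y. *)
Definition tighten p y x : R :=
  inf [set r | exists2 t, 0 <= t & r = p (x + t *: y) - t * p y].

(** The bound does not depend on [t], so the infimum defining [tighten] is a genuine one and not a
    default value. *)
Lemma tighten_lb p y x t : sublinear p -> 0 <= t ->
  - p (- x) <= p (x + t *: y) - t * p y.
Proof.
move=> sp t0; have := sp.1 (x + t *: y) (- x).
by rewrite addrAC subrr add0r sublinearZ//; lra.
Qed.

Lemma tighten_le p y x t : sublinear p -> 0 <= t ->
  tighten p y x <= p (x + t *: y) - t * p y.
Proof.
move=> sp t0; apply: ge_inf; last by exists t.
by exists (- p (- x)) => _ [s s0 ->]; exact: tighten_lb.
Qed.

Lemma tighten_ge p y x m :
  (forall t, 0 <= t -> m <= p (x + t *: y) - t * p y) -> m <= tighten p y x.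
Proof.
move=> h; apply: lb_le_inf; first by exists (p (x + 0 *: y) - 0 * p y), 0.
by move=> _ [t t0 ->]; exact: h.
Qed.

Lemma tighten_le_id p y x : sublinear p -> tighten p y x <= p x.
Proof.
by move=> sp; have := tighten_le p y x 0 sp (lexx _); rewrite scale0r addr0 mul0r subr0.
Qed.

Lemma tighten_opp p y : sublinear p -> tighten p y (- y) <= - p y.
Proof.
move=> sp; have := tighten_le p y (- y) 1 sp ler01.
by rewrite scale1r addNr sublinear0// mul1r sub0r.
Qed.

(** Parameters [t] for [x] and [s] for [z] combine to [t + s] for [x + z]; for homogeneity, [s] is
    traded for [t * s]. *)
Lemma sublinear_tighten p y : sublinear p -> sublinear (tighten p y).
Proof.
move=> sp; split=> [x z|t x t0].
  suff h t : 0 <= t -> tighten p y (x + z) - (p (x + t *: y) - t * p y)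
      <= tighten p y z.
    rewrite -lerBlDr; apply: tighten_ge => t t0.
    by have := h t t0; lra.
  move=> t0; apply: tighten_ge => s s0.
  have := tighten_le p y (x + z) (t + s) sp (addr_ge0 t0 s0).
  have := sp.1 (x + t *: y) (z + s *: y).
  by rewrite scalerDl addrACA mulrDl; lra.
rewrite -ler_pdivrMl//; apply: tighten_ge => s s0.
rewrite ler_pdivrMl//; apply: (le_trans (tighten_le p y _ (t * s) sp _)).
  by rewrite mulr_ge0// ltW.
by rewrite -scalerA -scalerDr (sublinearZ _ _ _ sp (ltW t0)) mulrBr mulrA.
Qed.

(** The pointwise infimum is finite because every member is at least [- p0 (- x)]. Subadditivity
    uses the chain condition: given one member for [x] and one for [y], the smaller of the two
    serves both. *)
Lemma sublinear_inf (A : set (V -> R)) p0 : A p0 ->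
  (forall p, A p -> sublinear p) ->
  (forall p q, A p -> A q -> (forall x, p x <= q x) \/ (forall x, q x <= p x)) ->
  (forall p, A p -> forall x, p x <= p0 x) ->
  exists2 q, sublinear q & forall p, A p -> forall x, q x <= p x.
Proof.
move=> Ap0 sA tA lep0.
pose q x := inf [set p x | p in A].
have lbA p x : A p -> - p0 (- x) <= p x.
  move=> Ap; have := sublinearN p x (sA _ Ap); have := lep0 _ Ap (- x); lra.
have qle p x : A p -> q x <= p x.
  move=> Ap; apply: ge_inf; last by exists p.
  by exists (- p0 (- x)) => _ [p' Ap' <-]; exact: lbA.
have qge (m : R) x : (forall p, A p -> m <= p x) -> m <= q x.
  move=> h; apply: lb_le_inf; first by exists (p0 x), p0.
  by move=> _ [p Ap <-]; exact: h.
exists q => [|p Ap x]; last exact: qle.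
split=> [x y|t x t0].
  rewrite -lerBlDr; apply/qge => p Ap; rewrite lerBlDr -lerBlDl.
  apply/qge => p' Ap'; rewrite lerBlDl.
  case: (tA _ _ Ap Ap') => h.
    apply: (le_trans (qle _ _ Ap)); apply: le_trans ((sA _ Ap).1 _ _) _.
    by rewrite lerD2l.
  apply: (le_trans (qle _ _ Ap')); apply: le_trans ((sA _ Ap').1 _ _) _.
  by rewrite lerD2r.
rewrite -ler_pdivrMl//; apply/qge => p Ap; rewrite ler_pdivrMl//.
by apply: le_trans ((sA _ Ap).2 _ _ t0); exact: qle.
Qed.

(* A minimal sublinear functional coincides with all its tightenings, which
   forces it to be odd, hence additive. *)
Lemma linear_below_sublinear p : sublinear p ->
  exists w : V -> R, [/\ forall x y, w (x + y) = w x + w y,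
    forall (t : R) x, w (t *: x) = t * w x & forall x, w x <= p x].
Proof.
move=> sp.
pose T := {q : V -> R | sublinear q /\ forall x, q x <= p x}.
(* The order is reversed, so that a maximal element for Zorn's lemma is a minimal functional. *)
pose ge_T (q r : T) := `[< forall x, sval r x <= sval q x >].
have [||A tA|[q [sq qp]] qmin] := @ZL_preorder T (exist _ p (conj sp (fun=> lexx _))) ge_T.
- by move=> q; apply/asboolP => x.
- move=> r s t /asboolP rs /asboolP st; apply/asboolP => x.
  exact: le_trans (st x) (rs x).
- have [[q0 Aq0]|A0] := pselect (exists q0 : T, A q0); last first.
    exists (exist _ p (conj sp (fun=> lexx _))) => s As.
    by exfalso; apply: A0; exists s.
  (* Only the chain members below [q0] are kept: [q0] is then a common upper bound inside the
     family, and the other members lie above [q0] anyway. *)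
  pose B := [set r | exists q : T, [/\ A q, ge_T q0 q & r = sval q]].
  have Bq0 : B (sval q0) by exists q0; split=> //; apply/asboolP => x.
  have sB r : B r -> sublinear r by move=> [[r' [sr' ?]] [_ _ ->]].
  have tB r s : B r -> B s -> (forall x, r x <= s x) \/ (forall x, s x <= r x).
    move=> [r' [Ar' _ ->]] [s' [As' _ ->]].
    by case: (tA _ _ Ar' As') => /asboolP; [right|left].
  have leB r : B r -> forall x, r x <= sval q0 x.
    by move=> [r' [_ /asboolP ? ->]].
  have [q sq qle] := sublinear_inf B (sval q0) Bq0 sB tB leB.
  have qp x : q x <= p x.
    by apply: le_trans (qle _ Bq0 x) _; case: (q0) => /= ? [_].
  exists (exist _ q (conj sq qp)) => s As; apply/asboolP => x /=.
  case: (tA _ _ Aq0 As) => /asboolP h.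
    by apply: qle; exists s; split=> //; apply/asboolP.
  by apply: le_trans (qle _ Bq0 x) (h x).
have odd y : q (- y) = - q y.
  have tp x : tighten q y x <= p x := le_trans (tighten_le_id q y x sq) (qp x).
  have /asboolP/(_ (- y)) /= h := qmin
    (exist _ (tighten q y) (conj (sublinear_tighten q y sq) tp))
    (asboolT (fun x => tighten_le_id q y x sq)).
  have := tighten_opp q y sq; have := sublinearN q (- y) sq; rewrite opprK; lra.
exists q; split=> // [x y|t x].
  have := sq.1 x y; have := sq.1 (- x) (- y); rewrite -opprD !odd; lra.
have [t0|t0] := leP 0 t; first exact: sublinearZ.
apply: oppr_inj; rewrite -odd -scaleNr -mulNr; apply: sublinearZ => //.
by rewrite oppr_ge0 ltW.
Qed.

(** A linear functional below [tighten p y] is at most [- p y] at [- y], hence at least [p y] at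
    [y]. *)
Lemma hahn_banach p y : sublinear p ->
  exists w : V -> R, [/\ forall x z, w (x + z) = w x + w z,
    forall (t : R) x, w (t *: x) = t * w x, forall x, w x <= p x & w y = p y].
Proof.
move=> sp.
have [w [wD wZ wp]] := linear_below_sublinear _ (sublinear_tighten p y sp).
have wle x : w x <= p x := le_trans (wp x) (tighten_le_id p y x sp).
exists w; split=> //; apply/eqP; rewrite eq_le wle /=.
have := le_trans (wp (- y)) (tighten_opp p y sp).
by rewrite -scaleN1r wZ mulN1r lerN2.
Qed.

End HahnBanach.

(** * States of a JB algebra *)

Lemma norm_rescale_lt1 {R : realType} {V : normedModType R} (x : V) (d : R) :
  0 < d -> `|(`|x| + d)^-1 *: x| < 1.
Proof.
move=> d0; have k0 : 0 < `|x| + d by rewrite ltr_wpDl.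
by rewrite normrZ gtr0_norm ?invr_gt0// ltr_pdivrMl// mulr1 ltrDl.
Qed.

Section JBAlgebra.
Context {R : realType} {V : completeNormedModType R}.
Context {mul : V -> V -> V} {e : V}.
Hypothesis JB : is_JB_algebra mul e.
Local Notation "a ** b" := (mul a b) (at level 40, left associativity).
Local Notation K := (JB_states mul e).

Let mulC a b : a ** b = b ** a.
Proof. by case: JB => -[]. Qed.

Let mulDl a b c : (a + b) ** c = a ** c + b ** c.
Proof. by case: JB => -[]. Qed.

Let mulDr a b c : c ** (a + b) = c ** a + c ** b.
Proof. by rewrite mulC mulDl !(mulC c). Qed.

Let mulZl (t : R) a b : (t *: a) ** b = t *: (a ** b).
Proof. by case: JB => -[]. Qed.

Let mulZr (t : R) a b : a ** (t *: b) = t *: (a ** b).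
Proof. by rewrite mulC mulZl mulC. Qed.

Let mulNl a b : (- a) ** b = - (a ** b).
Proof. by rewrite -scaleN1r mulZl scaleN1r. Qed.

Let mulNr a b : a ** (- b) = - (a ** b).
Proof. by rewrite mulC mulNl mulC. Qed.

Let mul1l a : e ** a = a.
Proof. by case: JB => -[]. Qed.

Let mul1r a : a ** e = a.
Proof. by rewrite mulC mul1l. Qed.

Let normM a b : `|a ** b| <= `|a| * `|b|.
Proof. by case: JB. Qed.

Let norm_sq a : `|a ** a| = `|a| ^+ 2.
Proof. by case: JB. Qed.

Let norm_sqD a b : `|a ** a| <= `|a ** a + b ** b|.
Proof. by case: JB. Qed.

(** Take [c = e - y], where [y] is the fixed point of [y = (x + y ** y) / 2]. This map is a
    contraction with constant [|x|] on the closed ball of radius [|x|], by completeness and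
    [y ** y - z ** z = (y - z) ** (y + z)]. *)
Lemma sub_norm_lt1_square x : `|x| < 1 -> exists c, e - x = c ** c.
Proof.
move=> x1; pose r := `|x|.
pose F y : V := 2^-1 *: (x + y ** y).
pose U : set V := [set y | `|y| <= r].
have FU : {homo F : y / U y >-> U y}.
  move=> y; rewrite /U /F /= => yr; rewrite normrZ ger0_norm ?invr_ge0//.
  have h1 : `|x + y ** y| <= `|x| + `|y| ^+ 2 by rewrite -norm_sq ler_normD.
  have h2 : `|y| ^+ 2 <= `|y| * 1.
    by rewrite expr2 ler_wpM2l//; apply: le_trans yr (ltW x1).
  by rewrite /r in yr *; lra.
pose f : {fun U >-> U} := HB.pack F (isFun.Build _ _ _ _ F FU).
have r0 : 0 <= r by exact: normr_ge0.
have ctr : is_contraction f.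
  exists (NngNum r0); split=> //= -[y z] [/= yr zr].
  rewrite /F -scalerBr normrZ ger0_norm ?invr_ge0//.
  rewrite opprD addrACA subrr add0r.
  have -> : y ** y - z ** z = (y - z) ** (y + z).
    by rewrite mulDl mulNl !mulDr (mulC z y) opprD addrA addrK.
  have h1 := normM (y - z) (y + z).
  have h2 : `|y - z| * `|y + z| <= `|y - z| * (r + r).
    by rewrite ler_wpM2l// (le_trans (ler_normD _ _))// lerD.
  by nra.
have [] := banach_fixed_point ctr.
- rewrite (_ : U = (fun y : V => `|y|) @^-1` [set s : R | s <= r]) //.
  apply: closed_comp; last exact: closed_le.
  by move=> y _; exact: norm_continuous.
- by exists 0; rewrite /U /= normr0.
move=> y Uy yF; exists (e - y).
have yy : 2%:R *: y = x + y ** y.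
  by rewrite [in LHS]yF /= scalerA mulfV ?scale1r// pnatr_eq0.
rewrite mulDl mulNl !mulDr !mulNr !mul1l !mul1r.
move: yy; rewrite scaler_nat mulr2n => yy.
have -> : x = y + y - y ** y by rewrite yy addrK.
by rewrite !opprD !opprK !addrA.
Qed.

(** For [|x| < 1] both [e - x] and [e + x] are squares, so [w x] lies between -1 and 1; the general
    case follows by rescaling with a margin [d] tending to 0. *)
Lemma state_le_norm w x : K w -> `|w x| <= `|x|.
Proof.
move=> [wD wZ _ w1 wsq].
have wN y : w (- y) = - w y by rewrite -scaleN1r wZ mulN1r.
have h (y : V) : `|y| < 1 -> w y <= 1.
  move=> /sub_norm_lt1_square[c cE].
  by have := wsq c; rewrite -cE wD wN w1 subr_ge0.
apply/ler_addgt0Pr => d d0.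
have k0 : 0 < `|x| + d by rewrite ltr_wpDl.
have kx := norm_rescale_lt1 x _ d0.
have h1 := h _ kx; have := h (- ((`|x| + d)^-1 *: x)).
rewrite normrN => /(_ kx); move: h1.
rewrite wN wZ -mulrN !ler_pdivrMl// mulr1 => h1 h2.
by rewrite ler_norml h1 lerNl h2.
Qed.


(** From [e ** e = e] the norm is 0 or 1; a state rules out [e = 0]. *)
Lemma norm_unit w : K w -> `|e| = 1.
Proof.
move=> [wD wZ _ w1 _].
have : `|e| = `|e| ^+ 2 by rewrite -norm_sq mul1l.
rewrite expr2 -[X in X = _]mulr1 => /(mulfI _) <- //.
rewrite normr_eq0; apply/eqP => e0.
by have := wZ 0 0; rewrite scale0r mul0r -e0 w1 => /eqP; rewrite oner_eq0.
Qed.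

(** A converse to [state_le_norm], which turns functionals from the Hahn-Banach theorem into
    states. *)
Lemma bounded_functional_state (w : V -> R) :
  (forall x y, w (x + y) = w x + w y) ->
  (forall (t : R) x, w (t *: x) = t * w x) ->
  (forall x, w x <= `|x|) -> w e = 1 -> `|e| = 1 -> K w.
Proof.
move=> wD wZ wle w1 e1.
have wN y : w (- y) = - w y by rewrite -scaleN1r wZ mulN1r.
have wabs y : `|w y| <= `|y|.
  by rewrite ler_norml lerNl -wN wle -(normrN y) wle.
split=> //.
  move=> x; apply/cvgrPdist_lt => d d0; near=> y.
  rewrite -wN -wD; apply: le_lt_trans (wabs _) _.
  by near: y; exact: cvgr_dist_lt.
(* For |b| < 1, e - b^2 = c^2 has norm at most |c^2 + b^2| = |e| = 1. *)
have h b : `|b| < 1 -> 0 <= w (b ** b).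
  move=> b1; have : `|b ** b| < 1 by rewrite norm_sq expr_lt1.
  move=> /sub_norm_lt1_square[c cE].
  have := norm_sqD c b; rewrite -cE subrK e1 => /(le_trans (wle _)).
  by rewrite wD wN w1; lra.
move=> a; pose k := `|a| + 1.
have k0 : 0 < k by rewrite /k ltr_wpDl.
have := h (k^-1 *: a).
move=> /(_ (norm_rescale_lt1 a _ ltr01)); rewrite mulZl mulZr !wZ.
by rewrite !pmulr_rge0// invr_gt0.
Unshelve. all: by end_near. Qed.

(** This says that tightening the norm along [e] does not lower its value at a square, as
    [norming_state] requires. *)
Lemma norm_square_add_unit a t : `|e| = 1 -> 0 <= t ->
  `|a ** a| + t <= `|a ** a + t *: e|.
Proof.
move=> e1 t0; set N := `|a ** a|.
have [->|N0] := eqVneq N 0.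
  rewrite add0r; have := norm_sqD (Num.sqrt t *: e) a.
  by rewrite mulZl mulZr mul1l scalerA -expr2 sqr_sqrtr// normrZ e1 mulr1
     ger0_norm// addrC.
have Ngt0 : 0 < N by rewrite lt_def N0 normr_ge0.
(* With N' > N and N' e - a^2 = g^2, N'(a^2 + t e) = (N' + t) a^2 + t g^2. *)
have h d : 0 < d -> (N + d + t) * N <= (N + d) * `|a ** a + t *: e|.
  move=> d0; have k0 : 0 < N + d by rewrite ltr_wpDl// normr_ge0.
  have := norm_rescale_lt1 (a ** a) _ d0; rewrite -/N.
  move=> /sub_norm_lt1_square[g gE].
  have := norm_sqD (Num.sqrt (N + d + t) *: a) (Num.sqrt (t * (N + d)) *: g).
  rewrite !mulZl !mulZr !scalerA -!expr2 !sqr_sqrtr ?mulr_ge0 ?addr_ge0 ?(ltW d0) ?(ltW Ngt0)//.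
  rewrite -gE scalerBr scalerA -mulrA mulfV ?gt_eqF// mulr1.
  have -> : (N + d + t) *: (a ** a) + ((t * (N + d)) *: e - t *: (a ** a))
      = (N + d) *: (a ** a + t *: e).
    by rewrite scalerDl addrACA subrr addr0 scalerDr scalerA [t * _]mulrC.
  by rewrite !normrZ !ger0_norm ?addr_ge0 ?(ltW d0) ?(ltW Ngt0).
rewrite -(ler_pM2l Ngt0); apply/ler_addgt0Pr => d d0.
have M0 : 0 <= `|a ** a + t *: e| by exact: normr_ge0.
(* With [d / M1] as margin, the error [d / M1 * |a ** a + t *: e|] stays below [d]; the added 1
   keeps [M1] positive. *)
pose M1 := `|a ** a + t *: e| + 1.
have dM : 0 < d / M1 by rewrite divr_gt0// /M1 ltr_wpDl.
have hM := h _ dM.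
have dE : d / M1 * `|a ** a + t *: e| = d - d / M1 by rewrite /M1; field; lra.
have dN : 0 <= d / M1 * N by rewrite mulr_ge0// ltW.
by move: hM; rewrite [leRHS]mulrDl dE; lra.
Qed.

(** Hahn-Banach is applied to the norm tightened along [e]: its value at [- e] is at most -1, which
    forces [w e = 1] and makes the functional a state. *)
Lemma norming_state a : `|e| = 1 -> exists2 w, K w & w (a ** a) = `|a ** a|.
Proof.
move=> e1.
have sn : sublinear (fun x : V => `|x|).
  by split=> [x y|t x t0]; rewrite ?ler_normD// normrZ gtr0_norm.
have sp := sublinear_tighten _ e sn.
have [w [wD wZ wle wa]] := hahn_banach _ (a ** a) sp.
have wn x : w x <= `|x| := le_trans (wle x) (tighten_le_id _ e x sn).
have we : w e = 1.
  apply/eqP; rewrite eq_le -{1}e1 wn /= -lerN2 -mulN1r -wZ scaleN1r -e1.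
  exact: le_trans (wle _) (tighten_opp _ e sn).
exists w; first exact: bounded_functional_state.
apply/eqP; rewrite eq_le wn /= wa; apply: tighten_ge => t t0.
by rewrite e1 mulr1 lerBrDr norm_square_add_unit.
Qed.

(** Positivity is tested on states rather than by being a square, since inequalities between affine
    functions on the separable states transfer in this form. *)
Definition JBpos c : Prop := forall w, K w -> 0 <= w c.

(** Here [e - c] is a square, so some state [u] attains its norm and [|e - c| = 1 - u c <= 1].
    Expanding [w ((e - c) ** (e - c)) <= 1] gives the claim. *)
Lemma state_sq_le c w : K w -> JBpos c -> `|c| < 1 -> w (c ** c) <= 2 * w c.
Proof.
move=> Kw c0 c1; have e1 := norm_unit _ Kw.
have [d dE] := sub_norm_lt1_square _ c1.
have : `|e - c| <= 1.
  have [u Ku] := norming_state d e1; rewrite -dE => <-.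
  case: (Ku) => uD uZ _ u1 _.
  by rewrite uD -scaleN1r uZ u1 mulN1r; have := c0 _ Ku; lra.
move=> h; have := le_trans (ler_norm _) (state_le_norm _ ((e - c) ** (e - c)) Kw).
rewrite norm_sq mulDl mulNl !mulDr !mulNr !mul1l !mul1r.
case: (Kw) => wD wZ _ w1 _.
have wN y : w (- y) = - w y by rewrite -scaleN1r wZ mulN1r.
rewrite !(wD, wN) w1.
have : `|e - c| ^+ 2 <= 1 by rewrite expr_le1.
by lra.
Qed.

(** After rescaling, [state_sq_le] gives [w (c ** c) = 0]; the rest is the Cauchy-Schwarz argument
    on squares of [x + t *: c]. *)
Lemma pos_ortho_mul c w x : K w -> JBpos c -> w c = 0 -> w (c ** x) = 0.
Proof.
move=> Kw c0 wc; case: (Kw) => wD wZ _ w1 wsq.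
have wcc : w (c ** c) = 0.
  pose k := `|c| + 1.
  have k0 : 0 < k by rewrite /k ltr_wpDl.
  have ck0 : JBpos (k^-1 *: c).
    move=> u Ku; case: (Ku) => _ uZ _ _ _; rewrite uZ mulr_ge0//.
      by rewrite invr_ge0 ltW.
    exact: c0.
  have := state_sq_le _ _ Kw ck0 (norm_rescale_lt1 c _ ltr01).
  rewrite mulZl mulZr !wZ wc !mulr0 pmulr_rle0 ?invr_gt0//.
  rewrite pmulr_rle0 ?invr_gt0// => h.
  by apply/eqP; rewrite eq_le h wsq.
have h t : 0 <= w (x ** x) + 2 * t * w (c ** x).
  have := wsq (x + t *: c).
  rewrite mulDl !mulDr !mulZl !mulZr (mulC x c) !(wD, wZ) wcc; lra.
have [//|n0] := eqVneq (w (c ** x)) 0.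
(* For this [t] the nonnegative expression would equal -1. *)
have := h (- (w (x ** x) + 1) / (2 * w (c ** x))).
rewrite (_ : 2 * _ * _ = - (w (x ** x) + 1)); first lra.
by field; rewrite n0.
Qed.

(** Orthogonality of [e - r *: a] to [a] under [w] reads [w a = r * w (a ** a)]. *)
Lemma state_sq_extreme a r w : K w -> JBpos (e - r *: a) -> r ^+ 2 = 1 ->
  w a = r -> w (a ** a) = 1.
Proof.
move=> Kw c0 r2 wa; case: (Kw) => wD wZ _ w1 _.
have wc : w (e - r *: a) = 0 by rewrite -scaleNr wD wZ w1 wa -r2; lra.
have := pos_ortho_mul _ _ a Kw c0 wc.
rewrite -scaleNr mulDl mulZl mul1l wD wZ wa => h.
have rn0 : r != 0 by apply/eqP => rE; move: r2; rewrite rE; lra.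
by apply: (mulfI rn0); lra.
Qed.

(** Both [w ((c + a) ** a)] and [w ((c - a) ** a)] vanish, and their difference is
    [2 * w (a ** a)]. *)
Lemma state_sq_null c a w : K w -> JBpos (c - a) -> JBpos (c + a) ->
  w c = 0 -> w a = 0 -> w (a ** a) = 0.
Proof.
move=> Kw pm pp wc wa; case: (Kw) => wD wZ _ _ _.
have wN y : w (- y) = - w y by rewrite -scaleN1r wZ mulN1r.
have hm : w (c - a) = 0 by rewrite wD wN wc wa subrr.
have hp : w (c + a) = 0 by rewrite wD wc wa addr0.
have := pos_ortho_mul _ _ a Kw pm hm; have := pos_ortho_mul _ _ a Kw pp hp.
by rewrite !mulDl mulNl !wD wN; lra.
Qed.

End JBAlgebra.

(** * Affine embeddings of convex sets of matrices *)

(** Fredholm alternative for finitely many functionals on a space of any dimension: the right-hand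
    side is attained as soon as it satisfies every linear relation among the functionals. *)
Lemma solve_functionals {R : realType} {V : lmodType R} (I : finType)
    (u : I -> V -> R) (h : I -> R) :
  (forall i x y, u i (x + y) = u i x + u i y) ->
  (forall i (t : R) x, u i (t *: x) = t * u i x) ->
  (forall c : I -> R, (forall v, \sum_i c i * u i v = 0) -> \sum_i c i * h i = 0) ->
  exists v, forall i, u i v = h i.
Proof.
move=> uD uZ compat; pose n := #|I|.
pose row_of v : 'rV[R]_n := \row_k u (enum_val k) v.
pose good (A : 'M[R]_n) :=
  forall x : 'rV[R]_n, (x <= A)%MS -> exists v, row_of v = x.
have rowD v w : row_of (v + w) = row_of v + row_of w.
  by apply/rowP => k; rewrite !mxE uD.
have rowZ t v : row_of (t *: v) = t *: row_of v.
  by apply/rowP => k; rewrite !mxE uZ.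
have good0 : exists k, `[< exists A, good A /\ \rank A = k >].
  exists 0%N; apply/asboolP; exists 0; split; last by rewrite mxrank0.
  move=> x; rewrite submx0 => /eqP ->; exists 0.
  by have := rowZ 0 0; rewrite !scale0r.
have goodn k : `[< exists A, good A /\ \rank A = k >] -> (k <= n)%N.
  by move=> /asboolP[A [_ <-]]; exact: rank_leq_row.
(* A matrix of maximal rank whose row space consists of attained values has all attained values in
   its row space. *)
case: (ex_maxnP good0 goodn) => k /asboolP[A [goodA rA]] maxA.
have rowA v : (row_of v <= A)%MS.
  apply/negPn/negP => nle.
  have gB : good (A + row_of v)%MS.
    move=> x /sub_addsmxP[[D E] /= ->].
    have [w wE] := goodA (D *m A) (submxMl _ _).
    exists (w + E 0 0 *: v); rewrite rowD rowZ wE.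
    by rewrite {2}(mx11_scalar E) mul_scalar_mx.
  have := maxA _ (asboolT (ex_intro _ _ (conj gB erefl))).
  rewrite -rA leqNgt => /negP; apply; apply: rank_ltmx.
  by rewrite ltmxE addsmxSl /=; apply: contra nle => /(submx_trans _); apply; exact: addsmxSr.
pose hr : 'rV[R]_n := \row_k h (enum_val k).
have [v vE] : exists v, row_of v = hr.
  (* Each column of the cokernel matrix is a relation among the functionals, so [compat] makes it
     annihilate [hr]. *)
  apply: goodA; rewrite submxE; apply/eqP/rowP => j; rewrite [RHS]mxE.
  have sumE (g : I -> R) : \sum_i cokermx A (enum_rank i) j * g i
      = ((\row_k g (enum_val k)) *m cokermx A) 0 j.
    rewrite mxE (reindex (@enum_rank I)) /=; last exact/onW_bij/enum_rank_bij.
    by apply: eq_bigr => i _; rewrite mxE enum_rankK mulrC.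
  rewrite -sumE; apply: compat => v; rewrite sumE.
  have := rowA v; by rewrite submxE => /eqP ->; rewrite mxE.
exists v => i; have /rowP/(_ (enum_rank i)) := vE.
by rewrite !mxE enum_rankK.
Qed.

Lemma separable_states_convex {R : realType} (rho sigma : 'M[complex R]_(2 * 2)) (t : R) :
  separable_states R rho -> separable_states R sigma -> 0 <= t <= 1 ->
  separable_states R ((t%:C)%C *: rho + ((1 - t)%:C)%C *: sigma).
Proof.
move=> [n [w [E [F [w0 w1 EF ->]]]]] [m [w' [E' [F' [w0' w1' EF' ->]]]]].
move=> /andP[t0 t1].
pose glue T (a : 'I_n -> T) (b : 'I_m -> T) (i : 'I_(n + m)) :=
  match fintype.split i with inl j => a j | inr j => b j end.
have gluel T a b j : glue T a b (lshift m j) = a j.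
  by rewrite /glue (unsplitK (inl j)).
have gluer T a b j : glue T a b (rshift n j) = b j.
  by rewrite /glue (unsplitK (inr j)).
exists (n + m)%N, (glue R (fun i => t * w i) (fun i => (1 - t) * w' i)),
  (glue _ E E'), (glue _ F F'); split.
- by move=> i; rewrite /glue; case: fintype.split => j; rewrite mulr_ge0// subr_ge0.
- rewrite big_split_ord /= (eq_bigr _ (fun i _ => gluel _ _ _ i)).
  rewrite (eq_bigr _ (fun i _ => gluer _ _ _ i)) -!mulr_sumr w1 w1'.
  by rewrite !mulr1 addrC subrK.
- by move=> i; rewrite /glue; case: fintype.split => j; [exact: EF|exact: EF'].
- rewrite big_split_ord /=; congr +%R; rewrite scaler_sumr; apply: eq_bigr => i _.
    by rewrite !gluel scalerA rmorphM.
  by rewrite !gluer scalerA rmorphM.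
Qed.

Section AffineEmbedding.
Context {R : realType} {m n : nat} {V : lmodType R}.
Context {S : set 'M[complex R]_(m, n)} {f : 'M[complex R]_(m, n) -> V -> R}.
Local Notation "t *% A" := ((t%:C)%C *: A) (at level 40).
Hypothesis S_convex : forall rho sigma (t : R), S rho -> S sigma -> 0 <= t <= 1 ->
  S (t *% rho + (1 - t) *% sigma).
Hypothesis f_affine : forall rho sigma (t : R), S rho -> S sigma -> 0 <= t <= 1 ->
  f (t *% rho + (1 - t) *% sigma) = (fun v => t * f rho v + (1 - t) * f sigma v).
Hypothesis S_neq0 : S !=set0.

(** A nonnegative combination collapses to its total weight times one point of [S], compatibly with
    [f], by merging points one at a time with two-point convexity. *)
Lemma affine_cone (I : Type) (s : seq I) (w : I -> R) (rho : I -> 'M[complex R]_(m, n)) :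
  (forall i, 0 <= w i) -> (forall i, S (rho i)) ->
  exists sigma, [/\ S sigma,
    \sum_(i <- s) w i *% rho i = (\sum_(i <- s) w i) *% sigma &
    forall v, \sum_(i <- s) w i * f (rho i) v = (\sum_(i <- s) w i) * f sigma v].
Proof.
move=> w0 Srho; elim: s => [|i s [sigma [Ss sE fE]]].
  have [sigma Ss] := S_neq0; exists sigma.
  by split=> // [|v]; rewrite !big_nil ?scale0r ?mul0r.
set W := \sum_(i <- s) w i in sE fE *.
have W0 : 0 <= W by apply: sumr_ge0.
have [T0|T0] := eqVneq (w i + W) 0.
  have wi0 : w i = 0 by have := w0 i; lra.
  have W00 : W = 0 by lra.
  exists sigma; split=> // [|v]; rewrite !big_cons -/W.
    by rewrite sE wi0 W00 add0r scale0r add0r.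
  by rewrite fE wi0 W00 add0r !mul0r add0r.
have Tgt0 : 0 < w i + W by rewrite lt_def T0 addr_ge0.
pose t := w i / (w i + W).
have t01 : 0 <= t <= 1.
  by rewrite /t divr_ge0 ?(ltW Tgt0)//= ler_pdivrMr// mul1r lerDl.
have tE : (w i + W) * t = w i by rewrite /t mulrC divfK.
have tE' : (w i + W) * (1 - t) = W by rewrite mulrBr mulr1 tE addrC addKr.
clearbody t; exists (t *% rho i + (1 - t) *% sigma); split; first exact: S_convex.
  by rewrite !big_cons -/W sE scalerDr !scalerA -!rmorphM tE tE'.
move=> v; rewrite !big_cons -/W fE (f_affine _ _ _ (Srho i) Ss t01).
by rewrite mulrDr !mulrA tE tE'.
Qed.

(** The positive and negative parts of [c] have the same total [T], and each part collapses to a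
    point by [affine_cone]. *)
Lemma affine_signed (I : finType) (c : I -> R) (rho : I -> 'M[complex R]_(m, n)) :
  (forall i, S (rho i)) -> \sum_i c i = 0 ->
  exists sigma tau T, [/\ S sigma, S tau,
    \sum_i c i *% rho i = T *% (sigma - tau) &
    forall v, \sum_i c i * f (rho i) v = T * (f sigma v - f tau v)].
Proof.
move=> Srho c0.
pose p i := Num.max (c i) 0; pose q i := Num.max (- c i) 0.
have cE i : c i = p i - q i by rewrite /p /q !maxEle; do !case: ifPn; lra.
have [sigma [Ss sE fsE]] := affine_cone I (index_enum I) p rho
  (fun i => ltac:(by rewrite /p le_max lexx orbT)) Srho.
have [tau [St tE ftE]] := affine_cone I (index_enum I) q rho
  (fun i => ltac:(by rewrite /q le_max lexx orbT)) Srho.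
have pq : \sum_i p i = \sum_i q i.
  by apply/eqP; rewrite -subr_eq0 -sumrB -(eq_bigr _ (fun i _ => cE i)) c0.
exists sigma, tau, (\sum_i p i); split=> // [|v].
  rewrite scalerBr {2}pq -sE -tE -sumrB; apply: eq_bigr => i _.
  by rewrite cE rmorphB scalerBl.
rewrite mulrBr {2}pq -fsE -ftE -sumrB; apply: eq_bigr => i _.
by rewrite cE mulrBl.
Qed.

(** In the form [T * (sigma - tau)], a vanishing combination has [T = 0] or [sigma = tau]; either
    way its image vanishes. *)
Lemma affine_relation (I : finType) (c : I -> R) (rho : I -> 'M[complex R]_(m, n)) :
  (forall i, S (rho i)) -> \sum_i c i = 0 -> \sum_i c i *% rho i = 0 ->
  forall v, \sum_i c i * f (rho i) v = 0.
Proof.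
move=> Srho c0 + v; have [s [t [T [Ss St -> ->]]]] := affine_signed _ _ _ Srho c0.
move=> /eqP; rewrite scaler_eq0 subr_eq0 => /orP[|/eqP ->]; last by rewrite subrr mulr0.
by rewrite -[0](rmorph0 (real_complex R)) => /eqP/complexI ->; rewrite mul0r.
Qed.

Lemma affine_relation_inj (I : finType) (c : I -> R) (rho : I -> 'M[complex R]_(m, n)) :
  {in S &, injective f} ->
  (forall i, S (rho i)) -> \sum_i c i = 0 ->
  (forall v, \sum_i c i * f (rho i) v = 0) -> \sum_i c i *% rho i = 0.
Proof.
move=> f_inj Srho c0; have [s [t [T [Ss St -> fE]]]] := affine_signed _ _ _ Srho c0.
have [->|T0 h] := eqVneq T 0; first by rewrite scale0r.
rewrite (_ : s = t) ?subrr ?scaler0//; apply: f_inj; rewrite ?inE//.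
apply/funext => v; have /eqP := h v.
by rewrite fE mulf_eq0 (negbTE T0) subr_eq0 => /eqP.
Qed.

Lemma affine_combination (I : finType) (c : I -> R) (rho : I -> 'M[complex R]_(m, n)) sigma :
  (forall i, S (rho i)) -> S sigma -> \sum_i c i = 1 ->
  sigma = \sum_i c i *% rho i ->
  forall v, f sigma v = \sum_i c i * f (rho i) v.
Proof.
move=> Srho Ss c1 sE v.
(* The point [sigma] joins the family with coefficient -1, making the total zero. *)
pose c' (o : unit + I) := if o is inr i then c i else -1.
pose rho' (o : unit + I) := if o is inr i then rho i else sigma.
have := affine_relation _ c' rho'; rewrite !big_sumType /= => /(_ _ _ _ v).
rewrite !big_sumType /= !big_const !card_unit /= !addr0 c1 addNr -sE.
rewrite rmorphN1 scaleN1r addNr mulN1r => h.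
by apply/eqP; rewrite eq_sym -subr_eq0 addrC h//; case.
Qed.

(** A relation among the [f (rho i)], evaluated at [e], has coefficient sum 0; injectivity then
    carries it to the [rho i] and so to the values of [g]. Hence [solve_functionals] applies, and
    the generating family extends the result to all of [S]. *)
Lemma affine_function_represented (I : finType) (rho : I -> 'M[complex R]_(m, n))
    (e : V) (g : 'M[complex R]_(m, n) -> R) :
  {in S &, injective f} ->
  (forall sigma, S sigma -> (forall x y, f sigma (x + y) = f sigma x + f sigma y) /\
     (forall (t : R) x, f sigma (t *: x) = t * f sigma x)) ->
  (forall sigma, S sigma -> f sigma e = 1) ->
  (forall A B, g (A + B) = g A + g B) -> (forall (t : R) A, g (t *% A) = t * g A) ->
  (forall i, S (rho i)) ->
  (forall sigma, S sigma -> exists c : I -> R,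
     \sum_i c i = 1 /\ sigma = \sum_i c i *% rho i) ->
  exists v, forall sigma, S sigma -> f sigma v = g sigma.
Proof.
move=> f_inj f_lin fe gD gZ Srho gen.
have g0 : g 0 = 0 by have := gZ 0 0; rewrite rmorph0 scale0r mul0r.
have gsum (c : I -> R) : g (\sum_i c i *% rho i) = \sum_i c i * g (rho i).
  by rewrite (big_morph g gD g0); apply: eq_bigr => i _; rewrite gZ.
have [||c h|v vE] := solve_functionals I (fun i => f (rho i)) (fun i => g (rho i)).
- by move=> i; case: (f_lin _ (Srho i)).
- by move=> i; case: (f_lin _ (Srho i)).
- have c0 : \sum_i c i = 0.
    by rewrite -[RHS](h e); apply: eq_bigr => i _; rewrite fe// mulr1.
  by rewrite -gsum affine_relation_inj// g0.
exists v => sigma Ss; have [c [c1 sE]] := gen _ Ss.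
rewrite (affine_combination _ _ _ _ Srho Ss c1 sE) sE gsum.
by apply: eq_bigr => i _; rewrite vE.
Qed.

End AffineEmbedding.

(** * Bloch coordinates *)

Section Bloch.
Context {R : realType}.
Local Notation C := (complex R).
Implicit Types (x y z : R) (E : 'M[C]_2).

(** This is [(1 + x sx + y sy + z sz) / 2] with the Pauli matrices [sx], [sy], [sz]. *)
Definition bloch x y z : 'M[C]_2 := \matrix_(i, j)
  if i == 0 then if j == 0 then ((1 + z) / 2)%:C%C else (x / 2 -i* (y / 2))%C
  else if j == 0 then (x / 2 +i* (y / 2))%C else ((1 - z) / 2)%:C%C.

Lemma ord2P (P : 'I_2 -> Prop) : P 0 -> P 1 -> forall i, P i.
Proof.
by move=> P0 P1 [[|[|//]] hi]; [move: P0|move: P1]; congr P; exact: val_inj.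
Qed.

Lemma det_mx22 (K : comNzRingType) (A : 'M[K]_2) :
  \det A = A 0 0 * A 1 1 - A 0 1 * A 1 0.
Proof.
rewrite (expand_det_row _ 0) !big_ord_recl big_ord0 addr0.
rewrite /cofactor !det_mx11 !mxE /= expr0 expr1 mul1r mulN1r mulrN.
by congr (_ * A _ _ - A _ _ * A _ _); exact: val_inj.
Qed.

Lemma mxrank_mx22 (K : fieldType) (A : 'M[K]_2) :
  A != 0 -> (\rank A == 1%N) = (\det A == 0).
Proof.
rewrite -mxrank_eq0 => r0; have r2 := rank_leq_row A.
have := row_free_unit A; rewrite unitmxE unitfE /row_free.
move: r0 r2; case: (\rank A) => [|[|[|k]]] //= _ _.
- by move=> /esym/negbFE ->.
- by move=> /esym/negPf ->.
Qed.

(** The determinant is [(1 - x^2 - y^2 - z^2) / 4], and the diagonal entries sum to 1, which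
    excludes rank 0. *)
Lemma bloch_rank_one x y z : x ^+ 2 + y ^+ 2 + z ^+ 2 = 1 ->
  rank_one_proj (bloch x y z).
Proof.
move=> h; split.
- apply/matrixP; apply: ord2P; apply: ord2P; rewrite !mxE /=;
    apply/eqP; rewrite eq_complex /=; apply/andP; split; apply/eqP; lra.
- apply/matrixP; apply: ord2P; apply: ord2P;
    rewrite !mxE !big_ord_recl big_ord0 !mxE /=;
    apply/eqP; rewrite eq_complex /=; apply/andP; split; apply/eqP; lra.
apply/eqP; rewrite mxrank_mx22.
  rewrite det_mx22 !mxE /= eq_complex /=; apply/andP; split; apply/eqP; lra.
apply/negP => /eqP/matrixP e0; have := e0 0 0; have := e0 1 1.
by rewrite !mxE /= => -[] h1 [] h2; lra.
Qed.

Lemma rank_one_bloch E : rank_one_proj E ->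
  exists x y z, x ^+ 2 + y ^+ 2 + z ^+ 2 = 1 /\ E = bloch x y z.
Proof.
move=> [/matrixP Eadj /matrixP Esq Erk].
have E0 : E != 0 by rewrite -mxrank_eq0 Erk.
have /eqP Edet : \det E == 0 by rewrite -mxrank_mx22// Erk.
move: Edet; rewrite det_mx22.
have := Eadj 0 0; have := Eadj 0 1; have := Eadj 1 1.
have := Esq 0 0; have := Esq 0 1; have := Esq 1 1.
rewrite !mxE !big_ord_recl !big_ord0 /=.
rewrite (_ : lift _ _ = 1); last exact: val_inj.
case e00 : (E 0 0) => [p p']; case e01 : (E 0 1) => [u v].
case e10 : (E 1 0) => [u' v']; case e11 : (E 1 1) => [q q'].
move=> /= [] s1 s1' [] s2 s2' [] s3 s3' [] a1 [] a2 a2' [] a3 [] d d'.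
have p'0 : p' = 0 by lra.
have q'0 : q' = 0 by lra.
have uu : u' = u by [].
have vv : v' = - v by lra.
move: s1 s2 s2' s3 d; rewrite uu vv p'0 q'0 => s1 s2 s2' s3 d.
(* Idempotence and zero determinant give [E = (p + q) E] entrywise on the diagonal, so the trace is
   0 or 1; trace 0 would make [E] vanish. *)
have T1 : p + q = 1.
  have hp : p * (p + q) = p by lra.
  have hq : q * (p + q) = q by lra.
  have [T0|T0] := eqVneq (p + q) 0; last first.
    by apply: (mulfI T0); rewrite mulrDl hp hq mulr1.
  have p0 : p = 0 by rewrite -hp T0 mulr0.
  have q0 : q = 0 by rewrite -hq T0 mulr0.
  have u0 : u = 0 by move: s2; rewrite p0 q0; lra.
  have v0 : v = 0 by move: s2'; rewrite p0 q0; lra.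
  case/eqP: E0; apply/matrixP; apply: ord2P; apply: ord2P; rewrite mxE.
  - by rewrite e00 p0 p'0.
  - by rewrite e01 u0 v0.
  - by rewrite e10 uu u0 vv v0 oppr0.
  - by rewrite e11 q0 q'0.
exists (2 * u), (- 2 * v), (p - q); split.
  have qE : q = 1 - p by lra.
  by rewrite qE in s1 d *; lra.
apply/matrixP; apply: ord2P; apply: ord2P; rewrite !mxE /= ?e00 ?e01 ?e10 ?e11;
  apply/eqP; rewrite eq_complex /=; apply/andP; split; apply/eqP; lra.
Qed.

(** The three differences are half the Pauli matrices, which makes the affine dependence on the
    coordinates explicit. *)
Lemma bloch_pauli x y z : bloch x y z = bloch 0 0 0
  + x%:C%C *: (bloch 1 0 0 - bloch 0 0 0)
  + y%:C%C *: (bloch 0 1 0 - bloch 0 0 0)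
  + z%:C%C *: (bloch 0 0 1 - bloch 0 0 0).
Proof.
have scaleE t (A B : 'M[C]_2) i j : (t%:C%C *: (A - B)) i j = t%:C%C * (A i j - B i j).
  by rewrite !mxE.
have addE (A B : 'M[C]_2) i j : (A + B) i j = A i j + B i j by rewrite mxE.
apply/matrixP => i j; rewrite 3!addE 3!scaleE /bloch 5!mxE.
elim/ord2P: i; elim/ord2P: j => /=;
  apply/eqP; rewrite eq_complex /=; apply/andP; split; apply/eqP; lra.
Qed.

Lemma bloch_affine (I : finType) (c x y z : I -> R) : \sum_i c i = 1 ->
  \sum_i (c i)%:C%C *: bloch (x i) (y i) (z i)
  = bloch (\sum_i c i * x i) (\sum_i c i * y i) (\sum_i c i * z i).
Proof.
move=> c1; rewrite [RHS]bloch_pauli.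
have B0 : bloch 0 0 0 = \sum_i (c i)%:C%C *: bloch 0 0 0.
  by rewrite -scaler_suml -rmorph_sum c1 scale1r.
rewrite [X in X + _ + _ + _]B0 !rmorph_sum !scaler_suml -!big_split /=.
apply: eq_bigr => i _; rewrite bloch_pauli 3!scalerDr 3!scalerA.
by rewrite -3!(rmorphM (real_complex R)).
Qed.

(** Four of the six octahedron vertices, [+x], [+y], [+z] and [-z]; they are affinely
    independent. *)
Definition octa_vertex (a : bool * bool) : 'M[C]_2 :=
  bloch (a.1 && a.2)%:R (a.1 && ~~ a.2)%:R
    (if a.1 then 0 else if a.2 then 1 else -1).

(** Signed barycentric coordinates: the weight missing from [x + y + z] is split equally between
    [+z] and [-z], where it cancels. *)
Definition octa_coord x y z (a : bool * bool) : R :=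
  if a.1 then (if a.2 then x else y)
  else (if a.2 then z + (1 - x - y - z) / 2 else (1 - x - y - z) / 2).

Lemma octa_vertex_rank_one a : rank_one_proj (octa_vertex a).
Proof. by case: a => [[] []]; apply: bloch_rank_one => /=; lra. Qed.

Lemma sum_bool_pair (F : bool * bool -> R) :
  \sum_a F a = F (true, true) + F (true, false) + F (false, true) + F (false, false).
Proof.
rewrite (eq_bigr (fun p => F (p.1, p.2))); last by case.
by rewrite -(pair_bigA _ (fun a b => F (a, b))) /= !big_bool /= addrA.
Qed.

Lemma sum_octa_coord x y z : \sum_a octa_coord x y z a = 1.
Proof. by rewrite sum_bool_pair /octa_coord /=; lra. Qed.

Lemma octa_combination x y z :
  bloch x y z = \sum_a (octa_coord x y z a)%:C%C *: octa_vertex a.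
Proof.
rewrite bloch_affine ?sum_octa_coord// !sum_bool_pair /octa_coord /=.
congr bloch; lra.
Qed.

(** * Tensor products and product states *)

Lemma tensmx_suml {K : pzRingType} {m n p q : nat} (I : finType) (c : I -> K)
    (A : I -> 'M[K]_(m, n)) (B : 'M[K]_(p, q)) :
  (\sum_i c i *: A i) *t B = \sum_i c i *: (A i *t B).
Proof.
apply/matrixP => k l; case: (mxtens_indexP k) => k1 k2; case: (mxtens_indexP l) => l1 l2.
rewrite tensmxE !summxE mulr_suml; apply: eq_bigr => i _.
by rewrite !mxE -mulrA !mxtens_indexK.
Qed.

Lemma tensmx_sumr {K : comPzRingType} {m n p q : nat} (I : finType) (c : I -> K)
    (A : 'M[K]_(m, n)) (B : I -> 'M[K]_(p, q)) :
  A *t (\sum_i c i *: B i) = \sum_i c i *: (A *t B i).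
Proof.
apply/matrixP => k l; case: (mxtens_indexP k) => k1 k2; case: (mxtens_indexP l) => l1 l2.
rewrite tensmxE !summxE mulr_sumr; apply: eq_bigr => i _.
by rewrite !mxE mulrCA !mxtens_indexK.
Qed.

Lemma separable_tens (E F : 'M[C]_2) : rank_one_proj E -> rank_one_proj F ->
  separable_states R (E *t F).
Proof.
move=> hE hF; exists 1%N, (fun=> 1), (fun=> E), (fun=> F).
by split=> //; rewrite big_ord1 // scale1r.
Qed.

Definition octa_tens (k : (bool * bool) * (bool * bool)) : 'M[C]_(2 * 2) :=
  octa_vertex k.1 *t octa_vertex k.2.

Lemma octa_tens_separable k : separable_states R (octa_tens k).
Proof. by apply: separable_tens; exact: octa_vertex_rank_one. Qed.

(** The coordinates of a product are the products of the coordinates, so sixteen product states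
    generate all separable states affinely. *)
Lemma separable_octa_combination (rho : 'M[C]_(2 * 2)) : separable_states R rho ->
  exists c : (bool * bool) * (bool * bool) -> R,
    \sum_k c k = 1 /\ rho = \sum_k (c k)%:C%C *: octa_tens k.
Proof.
move=> [n [w [E [F [w0 w1 EF ->]]]]].
have comb i : exists c : (bool * bool) * (bool * bool) -> R,
    \sum_k c k = 1 /\ E i *t F i = \sum_k (c k)%:C%C *: octa_tens k.
  have [/rank_one_bloch[x [y [z [_ ->]]]] /rank_one_bloch[x' [y' [z' [_ ->]]]]] := EF i.
  exists (fun k => octa_coord x y z k.1 * octa_coord x' y' z' k.2); split.
    rewrite -(pair_bigA _ (fun a b => octa_coord x y z a * octa_coord x' y' z' b)) /=.
    under eq_bigr do rewrite -mulr_sumr sum_octa_coord mulr1.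
    exact: sum_octa_coord.
  rewrite {1}octa_combination tensmx_suml.
  rewrite -(pair_bigA _ (fun a b => (octa_coord x y z a * octa_coord x' y' z' b)%:C%C
    *: octa_tens (a, b))) /=.
  apply: eq_bigr => a _; rewrite octa_combination tensmx_sumr scaler_sumr.
  by apply: eq_bigr => b _; rewrite scalerA rmorphM.
have /choice[c cP] := comb.
exists (fun k => \sum_i w i * c i k); split.
  rewrite exchange_big /=; under eq_bigr do rewrite -mulr_sumr (cP _).1 mulr1.
  exact: w1.
under eq_bigr do rewrite (cP _).2 scaler_sumr.
rewrite exchange_big /=; apply: eq_bigr => k _.
rewrite rmorph_sum scaler_suml; apply: eq_bigr => i _.
by rewrite scalerA rmorphM.
Qed.

Lemma mix_tensl (K : pzRingType) m n p q (a b : K) (A B : 'M[K]_(m, n)) (F : 'M[K]_(p, q)) :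
  a *: (A *t F) + b *: (B *t F) = (a *: A + b *: B) *t F.
Proof.
have := tensmx_suml _ (fun i : bool => if i then a else b) (fun i => if i then A else B) F.
by rewrite !big_bool /= => ->.
Qed.

Lemma mix_tensr (K : comPzRingType) m n p q (a b : K) (A : 'M[K]_(m, n)) (F G : 'M[K]_(p, q)) :
  a *: (A *t F) + b *: (A *t G) = A *t (a *: F + b *: G).
Proof.
have := tensmx_sumr _ (fun i : bool => if i then a else b) A (fun i => if i then F else G).
by rewrite !big_bool /= => ->.
Qed.

Lemma bloch_antipodal x y z :
  (2^-1)%:C%C *: bloch x y z + (1 - 2^-1)%:C%C *: bloch (- x) (- y) (- z) = bloch 0 0 0.
Proof.
have h : \sum_b (if b then 2^-1 else 1 - 2^-1 : R) = 1 by rewrite big_bool /=; lra.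
have := bloch_affine _ _ (fun b : bool => if b then x else - x)
  (fun b => if b then y else - y) (fun b => if b then z else - z) h.
by rewrite !big_bool /= => ->; congr bloch; lra.
Qed.

(** The average over the four sign choices is nested in two-point mixtures with weights [t] and
    [1 - t], the shape in which [f] is known to be affine. *)
Lemma mix_octahedron x y z :
  let mid (A B : 'M[C]_(2 * 2)) := (2^-1)%:C%C *: A + (1 - 2^-1)%:C%C *: B in
  let P s t := bloch (s * x) (s * y) (s * z) *t bloch (t * x) (t * y) (t * z) in
  mid (mid (P 1 1) (P 1 (-1))) (mid (P (-1) 1) (P (-1) (-1)))
  = bloch 0 0 0 *t bloch 0 0 0.
Proof.
by move=> /=; rewrite !mix_tensr !mulN1r !mul1r !bloch_antipodal mix_tensl bloch_antipodal.
Qed.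

End Bloch.

(** * Spin correlations *)

Section Correlations.
Context {R : realType}.
Local Notation C := (complex R).
Implicit Types (rho sigma : 'M[C]_(2 * 2)).

Definition re_entry rho (i j k l : 'I_2) : R :=
  complex.Re (rho (mxtens_index (i, j)) (mxtens_index (k, l))).

Definition corr_zz rho : R :=
  re_entry rho 0 0 0 0 - re_entry rho 0 1 0 1
  - re_entry rho 1 0 1 0 + re_entry rho 1 1 1 1.

(** The operator [sx (x) sx] flips both indices, so its trace against [rho] picks the antidiagonal
    entries. *)
Definition corr_xx rho : R :=
  re_entry rho 0 0 1 1 + re_entry rho 0 1 1 0
  + re_entry rho 1 0 0 1 + re_entry rho 1 1 0 0.

Lemma re_entryD rho sigma i j k l :
  re_entry (rho + sigma) i j k l = re_entry rho i j k l + re_entry sigma i j k l.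
Proof. by rewrite /re_entry mxE; case: (rho _ _) => ? ?; case: (sigma _ _). Qed.

Lemma re_entryZ (t : R) rho i j k l :
  re_entry (t%:C%C *: rho) i j k l = t * re_entry rho i j k l.
Proof. by rewrite /re_entry mxE; case: (rho _ _) => a b /=; rewrite mul0r subr0. Qed.

Lemma corr_zzD rho sigma : corr_zz (rho + sigma) = corr_zz rho + corr_zz sigma.
Proof. by rewrite /corr_zz !re_entryD; lra. Qed.

Lemma corr_xxD rho sigma : corr_xx (rho + sigma) = corr_xx rho + corr_xx sigma.
Proof. by rewrite /corr_xx !re_entryD; lra. Qed.

Lemma corr_zzZ (t : R) rho : corr_zz (t%:C%C *: rho) = t * corr_zz rho.
Proof. by rewrite /corr_zz !re_entryZ; lra. Qed.

Lemma corr_xxZ (t : R) rho : corr_xx (t%:C%C *: rho) = t * corr_xx rho.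
Proof. by rewrite /corr_xx !re_entryZ; lra. Qed.

Lemma corr_zz_bloch (x y z x' y' z' : R) :
  corr_zz (bloch x y z *t bloch x' y' z') = z * z'.
Proof. by rewrite /corr_zz /re_entry !tensmxE !mxE /=; lra. Qed.

Lemma corr_xx_bloch (x y z x' y' z' : R) :
  corr_xx (bloch x y z *t bloch x' y' z') = x * x'.
Proof. by rewrite /corr_xx /re_entry !tensmxE !mxE /=; lra. Qed.

(** By linearity it suffices to treat product states, where [2 s x x' <= (s x)^2 + x'^2], likewise
    for [z], and both Bloch vectors have length 1. A Bell state violates the bound. *)
Lemma corr_bound rho (s t : R) : separable_states R rho ->
  s ^+ 2 <= 1 -> t ^+ 2 <= 1 -> s * corr_xx rho + t * corr_zz rho <= 1.
Proof.
move=> [n [w [E [F [w0 w1 EF ->]]]]] s1 t1.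
have c0x : corr_xx 0 = 0 by have := corr_xxZ 0 0; rewrite scaler0 mul0r.
have c0z : corr_zz 0 = 0 by have := corr_zzZ 0 0; rewrite scaler0 mul0r.
rewrite (big_morph corr_xx corr_xxD c0x) (big_morph corr_zz corr_zzD c0z).
rewrite !mulr_sumr -big_split -w1 /=; apply: ler_sum => i _.
have [/rank_one_bloch[x [y [z [h ->]]]] /rank_one_bloch[x' [y' [z' [h' ->]]]]] := EF i.
rewrite corr_xxZ corr_zzZ corr_xx_bloch corr_zz_bloch.
rewrite mulrCA [t * _]mulrCA -mulrDr -[leRHS]mulr1 ler_wpM2l//.
have h1 : 0 <= (1 - s ^+ 2) * x ^+ 2 by rewrite mulr_ge0 ?sqr_ge0// subr_ge0.
have h2 : 0 <= (1 - t ^+ 2) * z ^+ 2 by rewrite mulr_ge0 ?sqr_ge0// subr_ge0.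
have := sqr_ge0 (s * x - x'); have := sqr_ge0 (t * z - z').
have := sqr_ge0 y; have := sqr_ge0 y'; lra.
Qed.

End Correlations.

(** * Contradiction at the maximally mixed state *)

Theorem theorem3 (R : realType) (V : completeNormedModType R)
  (mul : V -> V -> V) (e : V) :
  is_JB_algebra mul e ->
  ~ exists f : 'M[complex R]_(2 * 2) -> (V -> R),
      affine_iso (separable_states R) (JB_states mul e) f.
Proof.
move=> JB [f [[fS f_inj f_surj] f_aff]].
have fK rho : separable_states R rho -> JB_states mul e (f rho) by exact: fS.
have f_lin rho : separable_states R rho ->
    (forall x y, f rho (x + y) = f rho x + f rho y) /\
    (forall (t : R) x, f rho (t *: x) = t * f rho x).
  by move=> /fK[].
have fe rho : separable_states R rho -> f rho e = 1 by move=> /fK[].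
have f_affine rho sigma (t : R) : separable_states R rho -> separable_states R sigma ->
    0 <= t <= 1 -> f ((t%:C)%C *: rho + ((1 - t)%:C)%C *: sigma)
    = (fun v => t * f rho v + (1 - t) * f sigma v).
  by move=> Srho Ssigma; apply: f_aff; rewrite inE.
have S0 : separable_states R !=set0.
  by exists (octa_tens (true, true, (true, true))); exact: octa_tens_separable.
have represented g gD gZ := affine_function_represented (@separable_states_convex R)
  f_affine S0 _ octa_tens e g f_inj f_lin fe gD gZ octa_tens_separable
  separable_octa_combination.
have [xi xiE] := represented _ corr_xxD corr_xxZ.
have [ze zeE] := represented _ corr_zzD corr_zzZ.
(* Surjectivity of [f] carries [corr_bound] over to every state of the algebra. *)
have pos (s t : R) : s ^+ 2 <= 1 -> t ^+ 2 <= 1 ->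
    JBpos (mul := mul) (e := e) (e - s *: xi + t *: ze).
  move=> s1 t1 w Kw; have [rho Srho rhoE] := f_surj _ Kw.
  case: (Kw) => wD wZ _ w1 _.
  rewrite -scaleNr !wD !wZ w1 -rhoE xiE// zeE//.
  have := corr_bound rho s (- t) Srho s1; rewrite sqrrN => /(_ t1); lra.
pose P (x y z s t : R) := bloch (s * x) (s * y) (s * z) *t bloch (t * x) (t * y) (t * z).
have SP x y z s t : x ^+ 2 + y ^+ 2 + z ^+ 2 = 1 -> s ^+ 2 = 1 -> t ^+ 2 = 1 ->
    separable_states R (P x y z s t).
  move=> h s1 t1; apply: separable_tens; apply: bloch_rank_one;
    by rewrite !exprMn -!mulrDr h ?s1 ?t1 mulr1.
have center x y z c : x ^+ 2 + y ^+ 2 + z ^+ 2 = 1 ->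
    (forall s t, s ^+ 2 = 1 -> t ^+ 2 = 1 -> f (P x y z s t) (mul ze ze) = c) ->
    f (bloch 0 0 0 *t bloch 0 0 0) (mul ze ze) = c.
  move=> h fP; rewrite -(mix_octahedron x y z) /= -!/(P x y z _ _).
  have o1 : 1 ^+ 2 = 1 :> R by lra.
  have o2 : (-1) ^+ 2 = 1 :> R by lra.
  have half : 0 <= (2^-1 : R) <= 1 by apply/andP; split; lra.
  rewrite f_affine//; try by apply: separable_states_convex => //; apply: SP.
  rewrite !f_affine ?fP//; try exact: SP.
  by lra.
(* Along the x axis, [xi] takes the value [s * t], which is 1 or -1, and [ze] vanishes, so
   [state_sq_null] applies with [c = e - (s * t) *: xi]. *)
have c0 : f (bloch 0 0 0 *t bloch 0 0 0) (mul ze ze) = 0.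
  have h : 1 ^+ 2 + 0 ^+ 2 + 0 ^+ 2 = 1 :> R by lra.
  apply: (center 1 0 0 _ h) => s t s1 t1; have Sst := SP 1 0 0 s t h s1 t1.
  have st1 : (s * t) ^+ 2 <= 1 by rewrite exprMn s1 t1 mulr1.
  case: (fK _ Sst) => wD wZ _ w1 _.
  apply: (state_sq_null JB (e - (s * t) *: xi) _ _ (fK _ Sst)).
  - by have := pos (s * t) (-1) st1; rewrite scaleN1r; apply; lra.
  - by have := pos (s * t) 1 st1; rewrite scale1r; apply; lra.
  - rewrite -scaleNr wD wZ w1 xiE// corr_xx_bloch !mulr1.
    by rewrite mulNr -expr2 exprMn s1 t1 mulr1 subrr.
  - by rewrite zeE// corr_zz_bloch !mulr0.
(* Along the z axis, [ze] takes the extreme value [s * t], so [state_sq_extreme] applies. *)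
have c1 : f (bloch 0 0 0 *t bloch 0 0 0) (mul ze ze) = 1.
  have h : 0 ^+ 2 + 0 ^+ 2 + 1 ^+ 2 = 1 :> R by lra.
  apply: (center 0 0 1 _ h) => s t s1 t1; have Sst := SP 0 0 1 s t h s1 t1.
  have st1 : (s * t) ^+ 2 = 1 by rewrite exprMn s1 t1 mulr1.
  apply: (state_sq_extreme JB _ (s * t) _ (fK _ Sst)) => //.
    have := pos 0 (- (s * t)); rewrite scale0r subr0 scaleNr; apply; first by lra.
    by rewrite sqrrN st1.
  by rewrite zeE// corr_zz_bloch !mulr1.
by move: c0; rewrite c1 => /eqP; rewrite oner_eq0.
Qed.
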